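(* Let $V\in C^2(\mathbb{R},\mathbb{R})$ satisfy $V(x)\ge0$ for all $x$, $V(-1)=V(1)=0$, $V(x)>0$ for $x\in(-1,1)$, and $V''(-1),V''(1)>0$. Let $a:\mathbb{R}\to\mathbb{R}$ be continuous and coercive, i.e. $\inf_{t\in\mathbb{R}}a(t)>0$ and $a(t)\to+\infty$ as $|t|\to+\infty$. Then for all $\epsilon>0$ the problem $\ddot x(t)=a(\epsilon t)V'(x(t))$, $t\in\mathbb{R}$, $x(t)\to-1$ as $t\to-\infty$, $x(t)\to1$ as $t\to+\infty$, has a solution $x\in H^1_{loc}(\mathbb{R})\cap C^2(\mathbb{R})$. Moreover, $x(t)\in(-1,1)$ for all $t\in\mathbb{R}$. *)

(* Defs.v *)
From Stdlib Require Import Reals.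
From Coquelicot Require Import Coquelicot.
Open Scope R_scope.

Definition C2 (f : R -> R) : Prop :=
  forall t : R,
    ex_derive f t /\ ex_derive (Derive f) t /\ continuous (Derive (Derive f)) t.

(* Main.v *)
(** The heteroclinic is obtained as a limit of minimisers of the discretised action
    [sum (y_(i+1) - y_i)^2 / (2 h) + h A(t_i) V(y_i)], with [A t = a (eps t)], on the grid of
    mesh [h = 1/n] covering [[-n, n]], subject to [-1 <= y_i <= 1] and [y = -1], [y = 1] at
    the ends.  Since [V' = 0] at [-1] and [1], the constraint is never active and the minimiser
    solves the discrete Euler-Lagrange equation everywhere.  Comparison with a ramp bounds the
    action uniformly in [n].  As [A] tends to infinity, leaving a neighbourhood of [1] far to
    the right (or of [-1] far to the left) would cost more than this bound, so the boundary
    behaviour is uniform in [n] and survives in the limit.  Positions and difference quotients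
    converge pointwise along a free ultrafilter on [n]; second-order Taylor estimates that are
    uniform in [n] show that the limits are a [C^2] solution and its derivative.  Uniqueness
    for the Cauchy problem at the equilibria [-1] and [1] gives the strict bounds. *)
Require Import Defs.
From Stdlib Require Import Arith ZArith Reals Lra Lia Classical IndefiniteDescription.
From Coquelicot Require Import Coquelicot.
From mathcomp Require filter.
Open Scope R_scope.

(** * Ultralimits *)

(** Phrased with the [ProperFilter] of Coquelicot, so that its [filterlim] calculus applies along
    [U]. By [fu_eventually], whatever holds for all large [n] holds along [U]. *)
Record free_ultrafilter (U : (nat -> Prop) -> Prop) : Prop := {
  fu_proper : ProperFilter U;
  fu_ultra : forall P, U P \/ U (fun n => ~ P n);
  fu_eventually : forall P, eventually P -> U P }.

Lemma free_ultrafilter_exists : exists U, free_ultrafilter U.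
Proof.
  assert (HP : @filter.ProperFilter nat eventually).
  { split.
    - intros [N HN]; exact (HN N (Nat.le_refl N)).
    - split.
      + exists 0%nat; intros; exact I.
      + intros P Q HP HQ; exact (filter_and _ _ HP HQ).
      + intros P Q HPQ; exact (filter_imp _ _ HPQ). }
  destruct (filter.ultraFilterLemma HP) as [U [HU Hsub]].
  pose proof (filter.ultra_proper (F := U)) as HUp.
  destruct HUp as [H0 [HT HI HS]].
  exists U; split.
  - split.
    (* Properness here asks for a point in every member: a member without points would put the empty
       set into the filter. *)
    + intros P HPU; apply NNPP; intros Hn; apply H0.
      apply (HS P); [|exact HPU].
      intros n Hn'; apply Hn; exists n; exact Hn'.
    + split.
      * exact HT.
      * intros P Q HPU HQU; exact (HI P Q HPU HQU).
      * intros P Q HPQ; exact (HS P Q HPQ).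
  - intros P; exact (filter.in_ultra_setVsetC P HU).
  - exact Hsub.
Qed.

(** The limit is the supremum of the [r] with [r <= u n] for [U]-most [n]. The ultrafilter property
    gives the upper estimate: if [l + e / 2 <= u n] fails to hold along [U], its negation holds
    along [U]. *)
Lemma ultralimit_exists (U : (nat -> Prop) -> Prop) (u : nat -> R) (B : R) :
  free_ultrafilter U -> U (fun n => Rabs (u n) <= B) ->
  exists l : R, filterlim u U (locally l).
Proof.
  intros HU HB.
  pose proof (fu_proper U HU) as HF.
  set (E := fun r => U (fun n => r <= u n)).
  destruct (completeness E) as [l [Hub Hlub]].
  - exists B; intros r Hr.
    destruct (filter_ex _ (filter_and _ _ Hr HB)) as [n [H1 H2]].
    apply Rabs_le_between in H2; lra.
  - exists (- B); unfold E.
    apply filter_imp with (2 := HB); intros n Hn.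
    apply Rabs_le_between in Hn; lra.
  - exists l; apply filterlim_locally; intros e.
    pose proof (cond_pos e) as He.
    assert (H1 : U (fun n => l - e / 2 <= u n)).
    { apply NNPP; intros Hn.
      enough (l <= l - e / 2) by lra.
      apply Hlub; intros r Hr.
      apply Rnot_lt_le; intros Hlt; apply Hn.
      apply filter_imp with (2 := Hr); intros n; lra. }
    assert (H2 : U (fun n => ~ (l + e / 2 <= u n))).
    { destruct (fu_ultra U HU (fun n => l + e / 2 <= u n)) as [H|H]; [|exact H].
      apply Hub in H; lra. }
    apply filter_imp with (2 := filter_and _ _ H1 H2); intros n [H3 H4].
    apply Rabs_def1; unfold minus, plus, opp; simpl; lra.
Qed.

(** * Limit arithmetic for real functions along a filter *)

Section Limits.
Context {T : Type} {F : (T -> Prop) -> Prop} {FF : ProperFilter F}.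

Lemma filterlim_plus_R (f g : T -> R) (a b : R) :
  filterlim f F (locally a) -> filterlim g F (locally b) ->
  filterlim (fun n => f n + g n) F (locally (a + b)).
Proof.
  intros Hf Hg; apply (filterlim_comp_2 f g Rplus Hf Hg).
  exact (filterlim_plus (V := R_NormedModule) a b).
Qed.

Lemma filterlim_mult_R (f g : T -> R) (a b : R) :
  filterlim f F (locally a) -> filterlim g F (locally b) ->
  filterlim (fun n => f n * g n) F (locally (a * b)).
Proof.
  intros Hf Hg; apply (filterlim_comp_2 f g Rmult Hf Hg).
  exact (filterlim_mult (K := R_AbsRing) a b).
Qed.

Lemma filterlim_minus_R (f g : T -> R) (a b : R) :
  filterlim f F (locally a) -> filterlim g F (locally b) ->
  filterlim (fun n => f n - g n) F (locally (a - b)).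
Proof.
  intros Hf Hg; apply filterlim_plus_R; [exact Hf|].
  apply (filterlim_comp _ _ _ g Ropp F (locally b)); [exact Hg|].
  exact (filterlim_opp (V := R_NormedModule) b).
Qed.

Lemma filterlim_Rabs_R (f : T -> R) (a : R) :
  filterlim f F (locally a) -> filterlim (fun n => Rabs (f n)) F (locally (Rabs a)).
Proof.
  intros Hf; apply (filterlim_comp _ _ _ f Rabs F (locally a)); [exact Hf|].
  apply continuous_Rabs.
Qed.

Lemma filterlim_le_R (f g : T -> R) (a b : R) :
  F (fun n => f n <= g n) ->
  filterlim f F (locally a) -> filterlim g F (locally b) -> a <= b.
Proof.
  intros H Hf Hg; exact (filterlim_le f g a b H Hf Hg).
Qed.

End Limits.

(** * The discrete problem *)

Fixpoint psum (f : nat -> R) (n : nat) : R :=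
  match n with O => 0 | S m => psum f m + f m end.

Lemma psum_le (f g : nat -> R) (n : nat) :
  (forall k, (k < n)%nat -> f k <= g k) -> psum f n <= psum g n.
Proof.
  induction n as [|n IH]; simpl; intros H; [lra|].
  assert (f n <= g n) by (apply H; lia).
  assert (psum f n <= psum g n) by (apply IH; intros; apply H; lia). lra.
Qed.

Lemma psum_ge_0 (f : nat -> R) (n : nat) :
  (forall k, (k < n)%nat -> 0 <= f k) -> 0 <= psum f n.
Proof.
  induction n as [|n IH]; simpl; intros H; [lra|].
  assert (0 <= f n) by (apply H; lia).
  assert (0 <= psum f n) by (apply IH; intros; apply H; lia). lra.
Qed.

Lemma psum_diff (f : nat -> R) (n : nat) :
  psum (fun k => f (S k) - f k) n = f n - f 0%nat.
Proof. induction n as [|n IH]; simpl; lra. Qed.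

Lemma psum_scal (c : R) (f : nat -> R) (n : nat) :
  psum (fun k => c * f k) n = c * psum f n.
Proof. induction n as [|n IH]; simpl; [lra|rewrite IH; ring]. Qed.

Lemma psum_const (c : R) (n : nat) : psum (fun _ => c) n = INR n * c.
Proof.
  induction n as [|n IH]; [simpl; lra|].
  rewrite S_INR; simpl; rewrite IH; ring.
Qed.

Lemma psum_window (f : nat -> R) (i k n : nat) :
  (forall j, 0 <= f j) -> (i + k <= n)%nat ->
  psum (fun j => f (i + j)%nat) k <= psum f n.
Proof.
  intros Hf Hn.
  assert (H : forall m, psum f (i + m) = psum f i + psum (fun j => f (i + j)%nat) m).
  { induction m as [|m IH]; simpl; [rewrite Nat.add_0_r; lra|].
    rewrite Nat.add_succ_r; simpl; lra. }
  assert (H0 : 0 <= psum f i) by (apply psum_ge_0; auto).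
  replace n with ((i + k) + (n - (i + k)))%nat by lia.
  induction (n - (i + k))%nat as [|m IH].
  - rewrite Nat.add_0_r, H; lra.
  - rewrite Nat.add_succ_r; simpl. specialize (Hf (i + k + m)%nat); lra.
Qed.

(** Serves for variations of a single interior node: moving node [S p] affects only the summands [p]
    and [S p] of the action. *)
Lemma psum_change_two (f g : nat -> R) (p n : nat) :
  (S p < n)%nat -> (forall k, k <> p -> k <> S p -> f k = g k) ->
  psum f n - psum g n = f p - g p + (f (S p) - g (S p)).
Proof.
  intros Hp H.
  assert (H0 : forall m, (m <= p)%nat -> psum f m = psum g m).
  { induction m as [|m IH]; simpl; intros Hm; [lra|].
    rewrite IH, H by lia; lra. }
  induction n as [|n IH]; [lia|].
  destruct (Nat.eq_dec n (S p)) as [->|Hn].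
  - simpl; rewrite H0 by lia; lra.
  - simpl; rewrite H by lia. specialize (IH ltac:(lia)); lra.
Qed.

(** Cauchy-Schwarz for a telescoping sum, by induction on the number of terms. *)
Lemma square_increment_le (y : nat -> R) (k : nat) :
  (y k - y 0%nat) ^ 2 <= INR k * psum (fun j => (y (S j) - y j) ^ 2) k.
Proof.
  induction k as [|k IH]; [simpl; lra|].
  rewrite S_INR; simpl psum.
  set (s := psum _ k) in *; set (a := y k - y 0%nat) in *.
  set (b := y (S k) - y k).
  replace (y (S k) - y 0%nat) with (a + b) by (unfold a, b; ring).
  assert (Hs : 0 <= s) by (apply psum_ge_0; intros; apply pow2_ge_0).
  (* The case [k = 0] stands apart because the argument below divides by [K]. *)
  destruct k as [|k].
  - assert (Ha : a = 0) by (unfold a; ring). rewrite Ha; simpl; unfold b in *; nra.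
  - assert (HK : 0 < INR (S k)) by apply lt_0_INR, Nat.lt_0_succ.
    set (K := INR (S k)) in *.
    (* AM-GM: [2 a b <= a^2 / K + K b^2]. *)
    assert (H1 : a ^ 2 / K <= s).
    { apply Rmult_le_reg_l with K; [lra|]. field_simplify; lra. }
    assert (H2 : 0 <= (a / K - b) ^ 2 * K) by (apply Rmult_le_pos; [apply pow2_ge_0|lra]).
    replace ((a / K - b) ^ 2 * K) with (a ^ 2 / K - 2 * a * b + K * b ^ 2) in H2
      by (field; lra).
    nra.
Qed.

(** * Minimisers of the discrete action and their Euler-Lagrange equation *)

Definition energy (V : R -> R) (w : nat -> R) (N : nat) (y : nat -> R) : R :=
  psum (fun i => (y (S i) - y i) ^ 2 / 2 + w i * V (y i)) N.

(** The bounds are imposed at every index, also beyond [N], so that ultralimits of admissible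
    sequences exist at every index. *)
Definition admissible (N : nat) (y : nat -> R) : Prop :=
  y 0%nat = -1 /\ y N = 1 /\ forall i, -1 <= y i <= 1.

(** Direct method: the nodewise ultralimit of a minimising sequence is admissible, and the energy
    passes to the limit as a finite sum of continuous functions of the nodes. *)
Lemma energy_minimizer_exists (V : R -> R) (w : nat -> R) (N : nat) :
  (forall x, continuous V x) -> (forall x, 0 <= V x) -> (forall i, 0 <= w i) ->
  (0 < N)%nat ->
  exists y, admissible N y /\ forall z, admissible N z -> energy V w N y <= energy V w N z.
Proof.
  intros HVc HV Hw HN.
  assert (Hpos : forall y, 0 <= energy V w N y).
  { intros y; apply psum_ge_0; intros k _.
    assert (0 <= w k * V (y k)) by (apply Rmult_le_pos; auto).
    pose proof (pow2_ge_0 (y (S k) - y k)); lra. }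
  (* Completeness provides suprema, so energies are negated and [- m] is the infimum. The set is
     inhabited by the sequence that jumps from [-1] to [1] in its first step. *)
  set (E := fun r => exists z, admissible N z /\ r = - energy V w N z).
  destruct (completeness E) as [m [Hub Hlub]].
  - exists 0; intros r [z [_ ->]]; specialize (Hpos z); lra.
  - set (z := fun i => if Nat.eqb i 0 then -1 else 1).
    exists (- energy V w N z), z; split; [|reflexivity].
    unfold z; repeat split.
    + destruct N; [lia|reflexivity].
    + destruct (Nat.eqb i 0); lra.
    + destruct (Nat.eqb i 0); lra.
  - assert (Hz : forall k : nat, exists z,
      admissible N z /\ energy V w N z <= - m + / (INR k + 1)).
    { intros k; apply NNPP; intros Hn.
      assert (Hk : 0 < / (INR k + 1))
        by (apply Rinv_0_lt_compat; pose proof (pos_INR k); lra).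
      enough (m <= m - / (INR k + 1)) by lra.
      apply Hlub; intros r [z [Hz ->]].
      apply Rnot_lt_le; intros Hlt; apply Hn; exists z; split; [exact Hz|lra]. }
    destruct (functional_choice _ Hz) as [z Hzk].
    destruct free_ultrafilter_exists as [U HU].
    pose proof (fu_proper U HU) as HF.
    assert (Hy : forall i, exists l : R, filterlim (fun k => z k i) U (locally l)).
    { intros i; apply ultralimit_exists with 1; [exact HU|].
      apply filter_forall; intros k.
      apply Rabs_le_between, (proj1 (Hzk k)). }
    destruct (functional_choice _ Hy) as [y Hyi].
    assert (Hconst : forall i c, (forall k, z k i = c) -> y i = c).
    { intros i c Hc; apply Rle_antisym.
      - apply (filterlim_le_R (F := U) (fun k => z k i) (fun _ => c));
          [|apply Hyi|apply filterlim_const].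
        apply filter_forall; intros k; rewrite Hc; lra.
      - apply (filterlim_le_R (F := U) (fun _ => c) (fun k => z k i));
          [|apply filterlim_const|apply Hyi].
        apply filter_forall; intros k; rewrite Hc; lra. }
    exists y; split.
    + repeat split.
      * apply Hconst; intros k; apply (proj1 (Hzk k)).
      * apply Hconst; intros k; apply (proj1 (Hzk k)).
      * apply (filterlim_le_R (F := U) (fun _ => -1) (fun k => z k i));
          [|apply filterlim_const|apply Hyi].
        apply filter_forall; intros k; apply (proj1 (Hzk k)).
      * apply (filterlim_le_R (F := U) (fun k => z k i) (fun _ => 1));
          [|apply Hyi|apply filterlim_const].
        apply filter_forall; intros k; apply (proj1 (Hzk k)).
    + assert (Hlim : forall n,
        filterlim (fun k => energy V w n (z k)) U (locally (energy V w n y))).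
      { unfold energy; induction n as [|n IH]; simpl psum; [apply filterlim_const|].
        apply filterlim_plus_R; [exact IH|].
        apply filterlim_plus_R.
        - apply filterlim_mult_R; [|apply filterlim_const].
          simpl; repeat apply filterlim_mult_R; try apply filterlim_const;
            apply filterlim_minus_R; apply Hyi.
        - apply filterlim_mult_R; [apply filterlim_const|].
          apply (filterlim_comp _ _ _ (fun k => z k n) V U (locally (y n)));
            [apply Hyi|apply HVc]. }
      assert (Hm : energy V w N y <= - m).
      { apply le_epsilon; intros e He.
        apply (filterlim_le_R (F := U) (fun k => energy V w N (z k)) (fun _ => - m + e));
          [|apply Hlim|apply filterlim_const].
        apply (fu_eventually U HU).
        destruct (archimed_cor1 e He) as [n [Hn Hn0]].
        exists n; intros k Hk.
        apply Rle_trans with (1 := proj2 (Hzk k)).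
        apply Rplus_le_compat_l, Rlt_le, Rle_lt_trans with (2 := Hn).
        apply Rinv_le_contravar; [apply lt_0_INR; lia|].
        apply le_INR in Hk; lra. }
      intros z' Hz'. apply Rle_trans with (1 := Hm).
      assert (- energy V w N z' <= m) by (apply Hub; exists z'; auto). lra.
Qed.

(** One-sided, because a node at [-1] or [1] can be moved in one direction only. A negative [d]
    would make the difference quotient negative for small positive steps. *)
Lemma derive_ge_0_of_right_min (f : R -> R) (c d e : R) :
  is_derive f c d -> 0 < e -> (forall s, c < s < c + e -> f c <= f s) -> 0 <= d.
Proof.
  intros Hd He Hmin; apply Rnot_lt_le; intros Hneg.
  apply is_derive_Reals in Hd.
  destruct (Hd (- d / 2) ltac:(lra)) as [r Hr].
  pose proof (cond_pos r) as Hr0.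
  set (h := Rmin r e / 2).
  assert (Hh : 0 < h /\ h < r /\ h < e).
  { unfold h; pose proof (Rmin_l r e); pose proof (Rmin_r r e).
    assert (0 < Rmin r e) by (apply Rmin_pos; lra). lra. }
  specialize (Hr h ltac:(lra) ltac:(rewrite Rabs_pos_eq; lra)).
  apply Rabs_def2 in Hr.
  assert (H : 0 <= (f (c + h) - f c) / h).
  { apply Rmult_le_pos; [|apply Rlt_le, Rinv_0_lt_compat; lra].
    specialize (Hmin (c + h)); lra. }
  lra.
Qed.

Lemma derive_le_0_of_left_min (f : R -> R) (c d e : R) :
  is_derive f c d -> 0 < e -> (forall s, c - e < s < c -> f c <= f s) -> d <= 0.
Proof.
  intros Hd He Hmin.
  enough (0 <= - d) by lra.
  apply (derive_ge_0_of_right_min (fun s => f (- s)) (- c) (- d) e); [|exact He|].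
  - replace (- d) with (scal (-1) d) by (unfold scal; simpl; unfold mult; simpl; ring).
    apply (is_derive_comp f Ropp).
    + rewrite Ropp_involutive; exact Hd.
    + auto_derive; [exact I|ring].
  - intros s Hs; rewrite Ropp_involutive; apply Hmin; lra.
Qed.

(* The constraint [-1 <= y <= 1] is never active: if [y j = 1], the one-sided condition
   reads [(1 - y (j-1)) + (1 - y (j+1)) <= 0] as [V'(1) = 0], so equality holds. *)
Lemma energy_minimizer_equation (V : R -> R) (w : nat -> R) (N : nat) (y : nat -> R) :
  (forall x, ex_derive V x) -> Derive V (-1) = 0 -> Derive V 1 = 0 ->
  admissible N y -> (forall z, admissible N z -> energy V w N y <= energy V w N z) ->
  forall p, (S p < N)%nat ->
    y (S (S p)) - 2 * y (S p) + y p = w (S p) * Derive V (y (S p)).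
Proof.
  intros HV Hm1 H1 [Hy0 [HyN Hy]] Hmin p Hp.
  (* [phi] gathers the terms of the energy that vary with node [S p]; [d] is its derivative at
     [y (S p)], so [d = 0] is the equation sought. *)
  set (phi := fun s => (s - y p) ^ 2 / 2 + (y (S (S p)) - s) ^ 2 / 2 + w (S p) * V s).
  set (d := 2 * y (S p) - y p - y (S (S p)) + w (S p) * Derive V (y (S p))).
  assert (Hd : is_derive phi (y (S p)) d).
  { unfold phi, d; auto_derive; [apply HV|].
    replace (Derive (fun x => V x)) with (Derive V) by reflexivity; field. }
  assert (Hphi : forall s, -1 <= s <= 1 -> phi (y (S p)) <= phi s).
  { intros s Hs.
    set (z := fun i => if Nat.eqb i (S p) then s else y i).
    assert (HzS : z (S p) = s) by (unfold z; now rewrite Nat.eqb_refl).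
    assert (Hzn : forall i, i <> S p -> z i = y i).
    { intros i Hi; unfold z; now rewrite (proj2 (Nat.eqb_neq _ _) Hi). }
    assert (Hz : admissible N z).
    { repeat split; try (rewrite Hzn by lia; assumption).
      - unfold z; destruct (Nat.eqb i (S p)); [lra|apply Hy].
      - unfold z; destruct (Nat.eqb i (S p)); [lra|apply Hy]. }
    specialize (Hmin z Hz); unfold energy in Hmin.
    pose proof (psum_change_two (fun i => (z (S i) - z i) ^ 2 / 2 + w i * V (z i))
      (fun i => (y (S i) - y i) ^ 2 / 2 + w i * V (y i)) p N Hp) as Hc.
    cbv beta in Hc.
    rewrite HzS, (Hzn p), (Hzn (S (S p))) in Hc by lia.
    assert (Hc' := Hc ltac:(intros k Hk1 Hk2; rewrite !Hzn by lia; reflexivity)).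
    unfold phi; lra. }
  enough (d = 0) by (unfold d in *; lra).
  pose proof (Hy (S p)) as Hb; pose proof (Hy p) as Hb1; pose proof (Hy (S (S p))) as Hb2.
  assert (Hge : y (S p) < 1 -> 0 <= d).
  { intros Hlt; apply (derive_ge_0_of_right_min phi (y (S p)) d (1 - y (S p)) Hd); [lra|].
    intros s Hs; apply Hphi; lra. }
  assert (Hle : -1 < y (S p) -> d <= 0).
  { intros Hlt; apply (derive_le_0_of_left_min phi (y (S p)) d (y (S p) + 1) Hd); [lra|].
    intros s Hs; apply Hphi; lra. }
  destruct (Req_dec (y (S p)) 1) as [E|E].
  - assert (0 <= d) by (unfold d; rewrite E, H1; lra). lra.
  - destruct (Req_dec (y (S p)) (-1)) as [E'|E'].
    + assert (d <= 0) by (unfold d; rewrite E', Hm1; lra). lra.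
    + lra.
Qed.

(** * The grid problem and its uniform action bound *)

Definition grid (n i : nat) : R := - INR n + INR i / INR n.

Definition weight (A : R -> R) (n i : nat) : R := A (grid n i) / INR n ^ 2.

(* The action on the grid of mesh [1/n] covering [[-n, n]] is [n] times [energy]. *)
Record discrete_heteroclinic (V A : R -> R) (C : R) (n : nat) (y : nat -> R) : Prop := {
  dh_adm : admissible (2 * n * n) y;
  dh_eq : forall p, (S p < 2 * n * n)%nat ->
    y (S (S p)) - 2 * y (S p) + y p = weight A n (S p) * Derive V (y (S p));
  dh_energy : energy V (weight A n) (2 * n * n) y <= C / INR n }.

(** The competitor rests at [-1], climbs with unit slope during [[-1, 1]] and rests at [1]. Resting
    is free since [V] vanishes there; each of the [2 n] climbing steps costs at most
    [(1 / 2 + K) / n ^ 2]. *)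
Lemma ramp_energy (V A : R -> R) (K : R) (n : nat) :
  V (-1) = 0 -> V 1 = 0 -> (0 < n)%nat ->
  (forall t s, -1 <= t <= 1 -> -1 <= s <= 1 -> A t * V s <= K) ->
  exists z, admissible (2 * n * n) z /\
    energy V (weight A n) (2 * n * n) z <= (1 + 2 * K) / INR n.
Proof.
  intros Hm1 H1 Hn HK.
  assert (Hn0 : 0 < INR n) by (apply lt_0_INR; lia).
  assert (Hn1 : 1 <= INR n) by (apply (le_INR 1); lia).
  assert (Hi : 0 < / INR n) by (apply Rinv_0_lt_compat; lra).
  (* The indices [n * n - n] and [n * n + n] are the grid times [-1] and [1]. *)
  set (z := fun i => if Nat.leb i (n * n - n) then -1
                     else if Nat.leb (n * n + n) i then 1 else grid n i).
  assert (Hz1 : forall i, (i <= n * n - n)%nat -> z i = -1).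
  { intros i Hle; unfold z; now rewrite (proj2 (Nat.leb_le _ _) Hle). }
  assert (Hz2 : forall i, (n * n + n <= i)%nat -> z i = 1).
  { intros i Hle; unfold z; rewrite (proj2 (Nat.leb_gt _ _)) by lia.
    now rewrite (proj2 (Nat.leb_le _ _) Hle). }
  assert (Hnn : (n <= n * n)%nat) by nia.
  assert (Hz3 : forall i, (n * n - n <= i <= n * n + n)%nat ->
    z i = grid n i /\ -1 <= z i <= 1).
  { intros i [Hl Hr].
    assert (Hg : -1 <= grid n i <= 1).
    { apply le_INR in Hl, Hr; rewrite minus_INR, mult_INR in Hl by lia.
      rewrite plus_INR, mult_INR in Hr. unfold grid.
      split.
      - apply Rmult_le_reg_r with (INR n); [lra|]; field_simplify; [nra|lra].
      - apply Rmult_le_reg_r with (INR n); [lra|]; field_simplify; [nra|lra]. }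
    destruct (Nat.eq_dec i (n * n - n)) as [E|E].
    - rewrite Hz1 by lia; split; [|lra].
      rewrite E; unfold grid; rewrite minus_INR, mult_INR by lia; field; lra.
    - destruct (Nat.eq_dec i (n * n + n)) as [E'|E'].
      + rewrite Hz2 by lia; split; [|lra].
        rewrite E'; unfold grid; rewrite plus_INR, mult_INR; field; lra.
      + assert (Hz : z i = grid n i).
        { unfold z; rewrite (proj2 (Nat.leb_gt _ _)) by lia.
          now rewrite (proj2 (Nat.leb_gt _ _)) by lia. }
        rewrite Hz; auto. }
  assert (Hadm : admissible (2 * n * n) z).
  { split; [apply Hz1; lia|split; [apply Hz2; nia|]].
    intros i; destruct (le_lt_dec i (n * n - n)); [rewrite Hz1 by lia; lra|].
    destruct (le_lt_dec (n * n + n) i); [rewrite Hz2 by lia; lra|].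
    apply Hz3; lia. }
  exists z; split; [exact Hadm|].
  unfold energy.
  (* Each summand is bounded by a multiple of the increment of [z], so the sum telescopes to total
     rise [2] and no climbing steps need to be counted. *)
  apply Rle_trans with
    (psum (fun i => / INR n * (1 / 2 + K) * (z (S i) - z i)) (2 * n * n)).
  - apply psum_le; intros i _.
    destruct (le_lt_dec (S i) (n * n - n)) as [Ha|Ha].
    { rewrite !Hz1, Hm1 by lia; lra. }
    destruct (le_lt_dec (n * n + n) i) as [Hb|Hb].
    { rewrite !Hz2, H1 by lia; lra. }
    destruct (Hz3 i ltac:(lia)) as [E Hb1]; destruct (Hz3 (S i) ltac:(lia)) as [E' _].
    assert (Hd : z (S i) - z i = / INR n).
    { rewrite E, E'; unfold grid; rewrite S_INR; field; lra. }
    rewrite Hd; unfold weight.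
    assert (A (grid n i) * V (z i) <= K) by (apply HK; [rewrite <- E|]; exact Hb1).
    replace (A (grid n i) / INR n ^ 2 * V (z i))
      with (/ INR n ^ 2 * (A (grid n i) * V (z i))) by (field; lra).
    replace (/ INR n * (1 / 2 + K) * / INR n) with ((/ INR n) ^ 2 / 2 + / INR n ^ 2 * K)
      by (field; lra).
    apply Rplus_le_compat_l, Rmult_le_compat_l; [|assumption].
    apply Rlt_le, Rinv_0_lt_compat, pow_lt; lra.
  - rewrite psum_scal, psum_diff.
    destruct Hadm as [-> [-> _]]; apply Req_le; field; lra.
Qed.

Lemma discrete_heteroclinic_exists (V A : R -> R) (K : R) (n : nat) :
  C2 V -> (forall x, 0 <= V x) -> V (-1) = 0 -> V 1 = 0 ->
  Derive V (-1) = 0 -> Derive V 1 = 0 -> (forall t, 0 <= A t) -> (0 < n)%nat ->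
  (forall t s, -1 <= t <= 1 -> -1 <= s <= 1 -> A t * V s <= K) ->
  exists y, discrete_heteroclinic V A (1 + 2 * K) n y.
Proof.
  intros HV HV0 Hm1 H1 Hdm1 Hd1 HA Hn HK.
  destruct (energy_minimizer_exists V (weight A n) (2 * n * n)) as [y [Hy Hmin]].
  - intros x; apply (ex_derive_continuous (V := R_NormedModule)), HV.
  - exact HV0.
  - intros i; apply Rmult_le_pos; [apply HA|].
    apply Rlt_le, Rinv_0_lt_compat, pow_lt, lt_0_INR; lia.
  - nia.
  - exists y; split; [exact Hy| |].
    + apply energy_minimizer_equation; auto. intros x; apply HV.
    + destruct (ramp_energy V A K n Hm1 H1 Hn HK) as [z [Hz Hze]].
      apply Rle_trans with (2 := Hze); auto.
Qed.

(** * Action estimates on windows of consecutive indices *)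

Section Windows.
Context (V A : R -> R) (C : R) (n : nat) (y : nat -> R).
Context (HV : forall x, 0 <= V x) (HA : forall t, 0 <= A t) (Hn : (0 < n)%nat).
Context (Hy : discrete_heteroclinic V A C n y).

Lemma weight_ge_0 (i : nat) : 0 <= weight A n i.
Proof.
  apply Rmult_le_pos; [apply HA|].
  apply Rlt_le, Rinv_0_lt_compat, pow_lt, lt_0_INR; lia.
Qed.

Lemma window_energy (f : nat -> R) (i k : nat) :
  (forall j, 0 <= f j <= (y (S j) - y j) ^ 2 / 2 + weight A n j * V (y j)) ->
  (i + k <= 2 * n * n)%nat -> psum (fun j => f (i + j)%nat) k <= C / INR n.
Proof.
  intros Hf Hk.
  apply Rle_trans with (psum f (2 * n * n)).
  - apply psum_window; [apply Hf|exact Hk].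
  - apply Rle_trans with (2 := dh_energy _ _ _ _ _ Hy).
    apply psum_le; intros j _; apply Hf.
Qed.

(** A discrete Hölder estimate of exponent [1/2]: in terms of the elapsed time [k / n] the bound is
    [2 * C * (k / n)], uniformly in [n]. *)
Lemma window_increment (i k : nat) :
  (i + k <= 2 * n * n)%nat -> (y (i + k)%nat - y i) ^ 2 <= INR k * (2 * C / INR n).
Proof.
  intros Hk.
  pose proof (square_increment_le (fun j => y (i + j)%nat) k) as H; cbv beta in H.
  rewrite Nat.add_0_r in H.
  apply Rle_trans with (1 := H), Rmult_le_compat_l; [apply pos_INR|].
  assert (H2 : psum (fun j => (y (S (i + j)) - y (i + j)%nat) ^ 2 / 2) k <= C / INR n).
  { apply (window_energy (fun j => (y (S j) - y j) ^ 2 / 2) i k); [|exact Hk].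
    intros j; pose proof (pow2_ge_0 (y (S j) - y j)).
    assert (0 <= weight A n j * V (y j)) by (apply Rmult_le_pos; [apply weight_ge_0|apply HV]).
    lra. }
  replace (2 * C / INR n) with (2 * (C / INR n)) by (unfold Rdiv; ring).
  apply Rle_trans with (2 := Rmult_le_compat_l 2 _ _ ltac:(lra) H2).
  rewrite <- psum_scal; apply psum_le; intros j _.
  rewrite Nat.add_succ_r; lra.
Qed.

(** Limits the number of consecutive steps that can be spent where the potential term is at least
    [b]. *)
Lemma window_potential (b : R) (i k : nat) :
  (i + k <= 2 * n * n)%nat ->
  (forall j, (j < k)%nat -> b <= weight A n (i + j) * V (y (i + j)%nat)) ->
  INR k * b <= C / INR n.
Proof.
  intros Hk Hb.
  rewrite <- psum_const.
  apply Rle_trans with (psum (fun j => weight A n (i + j) * V (y (i + j)%nat)) k).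
  - apply psum_le; exact Hb.
  - apply (window_energy (fun j => weight A n j * V (y j)) i k); [|exact Hk].
    intros j; pose proof (pow2_ge_0 (y (S j) - y j)).
    assert (0 <= weight A n j * V (y j)) by (apply Rmult_le_pos; [apply weight_ge_0|apply HV]).
    lra.
Qed.

End Windows.

(** * Uniform behaviour near both ends of the grid *)

Lemma last_index (P : nat -> Prop) (i N : nat) :
  (i <= N)%nat -> P i -> ~ P N ->
  exists p, (i <= p < N)%nat /\ P p /\ forall k, (p < k <= N)%nat -> ~ P k.
Proof.
  intros Hi HPi; revert Hi; induction N as [|N IH]; intros Hi HN.
  - replace i with 0%nat in HPi by lia; tauto.
  - assert (i <> S N) by (intros ->; tauto).
    destruct (classic (P N)) as [HP|HP].
    + exists N; repeat split; [lia|lia|exact HP|].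
      intros k Hk; now replace k with (S N) by lia.
    + destruct (IH ltac:(lia) HP) as [p [Hp [HPp Hk]]].
      exists p; repeat split; [lia|lia|exact HPp|].
      intros k Hk'; destruct (Nat.eq_dec k (S N)) as [->|]; [exact HN|apply Hk; lia].
Qed.

(* After its last visit below [1 - d] the sequence needs more than [k] steps to leave the
   strip [[1 - d, 1 - d/2]] through the top, and each of them costs at least [b]. *)
Lemma crossing_too_expensive (y W : nat -> R) (N i k : nat) (d b D : R) :
  0 < d -> y N = 1 -> (i <= N)%nat ->
  (forall p q, (p + q <= N)%nat -> (y (p + q)%nat - y p) ^ 2 <= INR q * D) ->
  (forall p q, (0 < p)%nat -> (p + q <= N)%nat ->
    (forall j, (j < q)%nat -> b <= W (p + j)%nat) -> INR q * b <= D) ->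
  (forall p, (i <= p <= N)%nat -> 1 - d <= y p <= 1 - d / 2 -> b <= W p) ->
  0 <= D -> INR k * D <= (d / 2) ^ 2 -> D < INR k * b ->
  1 - d <= y i.
Proof.
  intros Hd HyN Hi Hinc Hpot Hb HD HkD HDk.
  apply Rnot_lt_le; intros Hlt.
  destruct (last_index (fun p => y p < 1 - d) i N Hi Hlt ltac:(lra)) as [p [Hp [Hyp Hlast]]].
  assert (Hstep : forall q, (q <= k)%nat -> (p + q <= N)%nat -> y (p + q)%nat <= 1 - d / 2).
  { intros q Hq HqN.
    pose proof (Hinc p q HqN) as H.
    assert (INR q * D <= INR k * D) by (apply Rmult_le_compat_r; [exact HD|apply le_INR, Hq]).
    enough (y (p + q)%nat - y p <= d / 2) by lra.
    apply Rnot_lt_le; intros Hc. nra. }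
  assert (HkN : (p + k < N)%nat).
  { destruct (le_lt_dec N (p + k)) as [H|H]; [|exact H].
    pose proof (Hstep (N - p)%nat ltac:(lia) ltac:(lia)) as H1.
    replace (p + (N - p))%nat with N in H1 by lia. lra. }
  enough (INR k * b <= D) by lra.
  (* The window starts just after the last visit below [1 - d], so all its [k] nodes lie in the
     strip. *)
  apply (Hpot (S p) k); [lia|lia|].
  intros j Hj; apply Hb; [lia|split].
  - apply Rnot_lt_le, Hlast; lia.
  - replace (S p + j)%nat with (p + S j)%nat by lia; apply Hstep; lia.
Qed.

Lemma grid_le (n i j : nat) : (0 < n)%nat -> (i <= j)%nat -> grid n i <= grid n j.
Proof.
  intros Hn Hij; apply Rplus_le_compat_l, Rmult_le_compat_r.
  - apply Rlt_le, Rinv_0_lt_compat, lt_0_INR, Hn.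
  - apply le_INR, Hij.
Qed.

Lemma positive_min (V : R -> R) (a b : R) :
  (forall x, continuous V x) -> a <= b -> (forall x, a <= x <= b -> 0 < V x) ->
  exists c, 0 < c /\ forall x, a <= x <= b -> c <= V x.
Proof.
  intros HV Hab Hpos.
  destruct (continuity_ab_min V a b Hab) as [m [Hm Hmab]].
  - intros c _; apply continuity_pt_filterlim, HV.
  - exists (V m); split; [apply Hpos; exact Hmab|exact Hm].
Qed.

Lemma discrete_heteroclinic_tails (V A : R -> R) (C d : R) :
  (forall x, continuous V x) -> (forall x, 0 <= V x) ->
  (forall x, -1 < x < 1 -> 0 < V x) -> (forall t, 0 <= A t) ->
  is_lim A p_infty p_infty -> is_lim A m_infty p_infty ->
  0 < C -> 0 < d < 1 ->
  exists (L : R) (n0 : nat), forall n y, (n0 <= n)%nat ->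
    discrete_heteroclinic V A C n y ->
    forall i, (i <= 2 * n * n)%nat ->
      (L <= grid n i -> 1 - d <= y i) /\ (grid n i <= - L -> y i <= -1 + d).
Proof.
  intros HVc HV HVpos HA Hp Hm HC Hd.
  destruct (positive_min V (1 - d) (1 - d / 2) HVc ltac:(lra)) as [c1 [Hc1 HV1]].
  { intros x Hx; apply HVpos; lra. }
  destruct (positive_min V (-1 + d / 2) (-1 + d) HVc ltac:(lra)) as [c2 [Hc2 HV2]].
  { intros x Hx; apply HVpos; lra. }
  set (c := Rmin c1 c2).
  assert (Hc : 0 < c) by (apply Rmin_pos; assumption).
  assert (Hcc1 : c <= c1) by apply Rmin_l.
  assert (Hcc2 : c <= c2) by apply Rmin_r.
  (* By the increment bound, crossing the strip takes time at least [T]; far out the action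
     density there is at least [B * c], and [T * (B * c) = 2 C] exceeds the action bound. *)
  set (T := d ^ 2 / (16 * C)).
  assert (HT : 0 < T) by (apply Rdiv_lt_0_compat; nra).
  set (B := 2 * C / (T * c)).
  assert (HTc : 0 < T * c) by (apply Rmult_lt_0_compat; assumption).
  assert (HB : 0 < B) by (apply Rdiv_lt_0_compat; lra).
  destruct (proj2 (is_lim_spec A p_infty p_infty) Hp B) as [L1 HL1].
  destruct (proj2 (is_lim_spec A m_infty p_infty) Hm B) as [L2 HL2].
  destruct (archimed_cor1 T HT) as [n0 [Hn0 Hn0']].
  (* The limits of [A] give [A > B] only strictly beyond [L1] and [L2]; the added [1] makes the weak
     inequalities on [grid n i] sufficient. *)
  exists (Rmax (L1 + 1) (- L2 + 1)), n0; intros n y Hn Hy i Hi.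
  pose proof (Rmax_l (L1 + 1) (- L2 + 1)) as HLl.
  pose proof (Rmax_r (L1 + 1) (- L2 + 1)) as HLr.
  set (L := Rmax (L1 + 1) (- L2 + 1)) in *.
  assert (Hnpos : (0 < n)%nat) by lia.
  assert (HnR : 0 < INR n) by (apply lt_0_INR; lia).
  assert (HnT : / INR n < T).
  { apply Rle_lt_trans with (2 := Hn0).
    apply Rinv_le_contravar; [apply lt_0_INR; lia|apply le_INR, Hn]. }
  assert (HnT1 : 1 < INR n * T).
  { apply Rmult_lt_reg_l with (/ INR n); [apply Rinv_0_lt_compat; lra|].
    replace (/ INR n * (INR n * T)) with T by (field; lra). lra. }
  (* Since [n * T > 1], this [k] lies strictly above [n * T] and at most at [2 * n * T]: the upper
     bound gives [HkD], the lower one [HDk]. *)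
  destruct (nfloor_ex (INR n * (2 * T))) as [k [Hk1 Hk2]]; [nra|].
  set (D := 2 * C / INR n).
  assert (HD : 0 <= D) by (apply Rlt_le, Rdiv_lt_0_compat; lra).
  assert (HCD : C / INR n <= D).
  { apply Rmult_le_compat_r; [apply Rlt_le, Rinv_0_lt_compat; lra|lra]. }
  set (b := B * c / INR n ^ 2).
  assert (HkD : INR k * D <= (d / 2) ^ 2).
  { apply Rle_trans with (INR n * (2 * T) * D).
    - apply Rmult_le_compat_r; assumption.
    - apply Req_le; unfold D, T; field; lra. }
  assert (HDk : D < INR k * b).
  { assert (Hb : INR n * T * b = D) by (unfold b, D, B; field; lra).
    rewrite <- Hb; apply Rmult_lt_compat_r; [|lra].
    apply Rdiv_lt_0_compat; [apply Rmult_lt_0_compat; lra|apply pow_lt; lra]. }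
  assert (Hinc : forall p q, (p + q <= 2 * n * n)%nat ->
    (y (p + q)%nat - y p) ^ 2 <= INR q * D).
  { intros p q; apply (window_increment V A C n y HV HA Hnpos Hy). }
  assert (Hpot : forall p q, (p + q <= 2 * n * n)%nat ->
    (forall j, (j < q)%nat -> b <= weight A n (p + j) * V (y (p + j)%nat)) ->
    INR q * b <= D).
  { intros p q Hpq Hj; apply Rle_trans with (2 := HCD).
    apply (window_potential V A C n y HV HA Hnpos Hy b p q Hpq Hj). }
  assert (Hw : forall p, B <= A (grid n p) -> c <= V (y p) -> b <= weight A n p * V (y p)).
  { intros p HBp Hcp; unfold b, weight.
    replace (A (grid n p) / INR n ^ 2 * V (y p))
      with (A (grid n p) * V (y p) / INR n ^ 2) by (field; lra).
    apply Rmult_le_compat_r; [apply Rlt_le, Rinv_0_lt_compat, pow_lt; lra|].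
    apply Rmult_le_compat; lra. }
  destruct (dh_adm _ _ _ _ _ Hy) as [Hy0 [HyN _]].
  split; intros HL.
  - apply (crossing_too_expensive y (fun p => weight A n p * V (y p)) (2 * n * n) i k d b D);
      auto; try lra.
    { intros p q _; apply Hpot. }
    intros p Hip Hyp; apply Hw.
    + apply Rlt_le, HL1. pose proof (grid_le n i p Hnpos ltac:(lia)); lra.
    + apply Rle_trans with (1 := Hcc1), HV1, Hyp.
  (* The left end reduces to the right one by reversing the indices and changing the sign of [y]. *)
  - set (N := (2 * n * n)%nat) in *.
    enough (H : 1 - d <= - y (N - (N - i))%nat)
      by (replace (N - (N - i))%nat with i in H by lia; lra).
    apply (crossing_too_expensive (fun p => - y (N - p)%nat)
      (fun p => weight A n (N - p) * V (y (N - p)%nat)) N (N - i) k d b D); auto; try lra.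
    + rewrite Nat.sub_diag; lra.
    + lia.
    + intros p q Hpq.
      pose proof (Hinc (N - (p + q))%nat q ltac:(lia)) as H.
      replace (N - (p + q) + q)%nat with (N - p)%nat in H by lia.
      nra.
    (* The reversed window of nodes [N - (p + j)] starts at [S (N - (p + q))]; it ends within the
       grid because [0 < p]. *)
    + intros p q Hp0 Hpq Hj.
      apply (Hpot (S (N - (p + q))) q ltac:(lia)).
      intros j Hjq.
      specialize (Hj (q - S j)%nat ltac:(lia)).
      now replace (N - (p + (q - S j)))%nat with (S (N - (p + q)) + j)%nat in Hj by lia.
    + intros p Hip Hyp; apply Hw.
      * apply Rlt_le, HL2.
        pose proof (grid_le n (N - p) i Hnpos ltac:(lia)); lra.
      * apply Rle_trans with (1 := Hcc2), HV2; lra.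
Qed.

(** * Passage to the limit *)

Lemma continuous_bounded (f : R -> R) (r : R) :
  (forall x, continuous f x) -> 0 <= r ->
  exists M, 0 < M /\ forall x, - r <= x <= r -> Rabs (f x) <= M.
Proof.
  intros Hf Hr.
  destruct (continuity_ab_maj (fun x => Rabs (f x)) (- r) r) as [m [Hm _]]; [lra| |].
  - intros c _; apply continuity_pt_filterlim.
    apply (continuous_comp f Rabs); [apply Hf|apply continuous_Rabs].
  - exists (Rabs (f m) + 1); split.
    + pose proof (Rabs_pos (f m)); lra.
    + intros x Hx; specialize (Hm x Hx); simpl in Hm; lra.
Qed.

(** The division-free form of differentiability, which is what Taylor estimates deliver. *)
Lemma is_derive_intro (f : R -> R) (t l : R) :
  (forall e, 0 < e -> exists d, 0 < d /\
    forall s, Rabs (s - t) < d -> Rabs (f s - f t - (s - t) * l) <= e * Rabs (s - t)) ->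
  is_derive f t l.
Proof.
  intros H; apply is_derive_Reals; intros e He.
  destruct (H (e / 2) ltac:(lra)) as [d [Hd Hf]].
  exists (mkposreal d Hd); simpl; intros h Hh Hhd.
  specialize (Hf (t + h)).
  replace (t + h - t) with h in Hf by ring.
  specialize (Hf Hhd).
  pose proof (Rabs_pos_lt h Hh) as Hh0.
  apply Rmult_lt_reg_r with (Rabs h); [exact Hh0|].
  rewrite <- Rabs_mult.
  replace (((f (t + h) - f t) / h - l) * h) with (f (t + h) - f t - h * l) by (field; exact Hh).
  nra.
Qed.

(** * First- and second-order estimates on the grid *)

Definition velocity (n : nat) (y : nat -> R) (i : nat) : R := (y (S i) - y i) * INR n.

(** Sums the discrete equation, in which each step changes the velocity by force over [n]. Taking
    [g = 0] yields a Lipschitz bound; taking for [g] the force at the limit point yields the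
    acceleration. *)
Lemma velocity_increment (V A : R -> R) (C : R) (n : nat) (y : nat -> R) (g e : R) (i k : nat) :
  (0 < n)%nat -> discrete_heteroclinic V A C n y -> (i + k < 2 * n * n)%nat ->
  (forall p, (i < p <= i + k)%nat -> Rabs (A (grid n p) * Derive V (y p) - g) <= e) ->
  Rabs (velocity n y (i + k) - velocity n y i - INR k / INR n * g) <= INR k / INR n * e.
Proof.
  intros Hn Hy Hk He.
  assert (HnR : 0 < INR n) by (apply lt_0_INR, Hn).
  induction k as [|k IH].
  - rewrite Nat.add_0_r; simpl INR.
    replace (_ - _ - _) with 0 by (unfold Rdiv; ring).
    rewrite Rabs_R0; unfold Rdiv; lra.
  - specialize (IH ltac:(lia) ltac:(intros; apply He; lia)).
    specialize (He (S (i + k)) ltac:(lia)).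
    pose proof (dh_eq _ _ _ _ _ Hy (i + k) ltac:(lia)) as Heq.
    set (F := A (grid n (S (i + k))) * Derive V (y (S (i + k)))) in *.
    assert (Hv : velocity n y (S (i + k)) - velocity n y (i + k) = F / INR n).
    { unfold velocity.
      replace (_ - _) with ((y (S (S (i + k))) - 2 * y (S (i + k)) + y (i + k)%nat) * INR n)
        by ring.
      rewrite Heq; unfold F, weight; field; lra. }
    rewrite Nat.add_succ_r, S_INR.
    replace (velocity n y (S (i + k)) - velocity n y i - (INR k + 1) / INR n * g)
      with ((velocity n y (i + k) - velocity n y i - INR k / INR n * g)
            + (velocity n y (S (i + k)) - velocity n y (i + k) - g / INR n))
      by (field; lra).
    apply Rle_trans with (1 := Rabs_triang _ _).
    replace ((INR k + 1) / INR n * e) with (INR k / INR n * e + e / INR n) by (field; lra).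
    apply Rplus_le_compat; [exact IH|].
    rewrite Hv.
    replace (F / INR n - g / INR n) with ((F - g) * / INR n) by (field; lra).
    rewrite Rabs_mult, (Rabs_pos_eq (/ INR n)) by (apply Rlt_le, Rinv_0_lt_compat, HnR).
    apply Rmult_le_compat_r; [apply Rlt_le, Rinv_0_lt_compat, HnR|exact He].
Qed.

(** Sums the velocities. The induction uses [(k + 1) ^ 2 >= k ^ 2 + k], which already suffices for
    the constant [M]. *)
Lemma position_increment (n : nat) (y : nat -> R) (M : R) (i k : nat) :
  (0 < n)%nat -> 0 <= M ->
  (forall p, (p < k)%nat ->
    Rabs (velocity n y (i + p) - velocity n y i) <= INR p / INR n * M) ->
  Rabs (y (i + k)%nat - y i - INR k / INR n * velocity n y i) <= M * (INR k / INR n) ^ 2.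
Proof.
  intros Hn HM0 HM.
  assert (HnR : 0 < INR n) by (apply lt_0_INR, Hn).
  assert (Hi : 0 < / INR n) by (apply Rinv_0_lt_compat, HnR).
  induction k as [|k IH].
  - rewrite Nat.add_0_r; simpl INR.
    replace (_ - _ - _) with 0 by (unfold Rdiv; ring).
    rewrite Rabs_R0; unfold Rdiv; lra.
  - specialize (IH ltac:(intros; apply HM; lia)).
    specialize (HM k ltac:(lia)).
    assert (Hv : y (S (i + k)) - y (i + k)%nat = velocity n y (i + k) * / INR n)
      by (unfold velocity; field; lra).
    rewrite Nat.add_succ_r, S_INR.
    replace (y (S (i + k)) - y i - (INR k + 1) / INR n * velocity n y i)
      with ((y (i + k)%nat - y i - INR k / INR n * velocity n y i)
            + (velocity n y (i + k) - velocity n y i) * / INR n)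
      by (replace (y (S (i + k))) with (y (i + k)%nat + velocity n y (i + k) * / INR n) by lra;
          field; lra).
    apply Rle_trans with (1 := Rabs_triang _ _).
    rewrite Rabs_mult, (Rabs_pos_eq (/ INR n)) by lra.
    apply (Rmult_le_compat_r (/ INR n)) in HM; [|lra].
    assert (0 <= INR k / INR n ^ 2 * M /\ 0 <= / INR n ^ 2 * M).
    { pose proof (pos_INR k).
      assert (0 < / INR n ^ 2) by (apply Rinv_0_lt_compat, pow_lt, HnR).
      split; [|apply Rmult_le_pos; lra].
      apply Rmult_le_pos; [apply Rmult_le_pos; lra|exact HM0]. }
    replace (M * ((INR k + 1) / INR n) ^ 2) with
      (M * (INR k / INR n) ^ 2 + INR k / INR n * M * / INR n
       + (INR k / INR n ^ 2 * M + / INR n ^ 2 * M)) by (field; lra).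
    lra.
Qed.

(** The grid node at or just left of [t]. For [t < - n] the truncation [Z.to_nat] returns [0]; each
    fixed [t] lies in [[-n, n]] for all large [n]. *)
Definition index (n : nat) (t : R) : nat := Z.to_nat (Int_part ((t + INR n) * INR n)).

Lemma index_spec (n : nat) (t : R) : (0 < n)%nat -> Rabs t <= INR n ->
  grid n (index n t) <= t < grid n (index n t) + / INR n.
Proof.
  intros Hn Ht; apply Rabs_le_between in Ht.
  assert (HnR : 0 < INR n) by (apply lt_0_INR, Hn).
  set (r := (t + INR n) * INR n).
  assert (Hr : 0 <= r) by (apply Rmult_le_pos; lra).
  destruct (base_Int_part r) as [H1 H2].
  assert (Hz : (0 <= Int_part r)%Z).
  { apply Z.lt_succ_r, lt_IZR; rewrite succ_IZR; simpl; lra. }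
  assert (E : INR (index n t) = IZR (Int_part r)).
  { unfold index; fold r; rewrite INR_IZR_INZ, Z2Nat.id by exact Hz; reflexivity. }
  unfold grid; rewrite E.
  assert (Et : t = - INR n + r / INR n) by (unfold r; field; lra).
  assert (Hi : 0 < / INR n) by (apply Rinv_0_lt_compat, HnR).
  assert (H3 : IZR (Int_part r) * / INR n <= r * / INR n) by (apply Rmult_le_compat_r; lra).
  assert (H4 : r * / INR n < (IZR (Int_part r) + 1) * / INR n)
    by (apply Rmult_lt_compat_r; lra).
  unfold Rdiv in *; lra.
Qed.

(** Leaves [n] further steps, that is one unit of time, to the right of the node of [t]. *)
Lemma index_range (n : nat) (t : R) : Rabs t + 2 <= INR n ->
  (index n t + n <= 2 * n * n)%nat.
Proof.
  intros Ht.
  pose proof (Rabs_pos t).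
  assert (Hn : (0 < n)%nat) by (apply INR_lt; simpl; lra).
  destruct (index_spec n t Hn ltac:(lra)) as [H1 _].
  apply INR_le; rewrite plus_INR, !mult_INR; simpl (INR 2).
  pose proof (Rle_abs t).
  assert (E : INR (index n t) = (grid n (index n t) + INR n) * INR n)
    by (unfold grid; field; lra).
  rewrite E; nra.
Qed.

Lemma index_le (n : nat) (s t : R) : (0 < n)%nat -> Rabs s <= INR n -> Rabs t <= INR n ->
  s <= t -> (index n s <= index n t)%nat.
Proof.
  intros Hn Hs Ht Hst.
  assert (HnR : 0 < INR n) by (apply lt_0_INR, Hn).
  destruct (index_spec n s Hn Hs) as [H1 H2]; destruct (index_spec n t Hn Ht) as [H3 H4].
  apply Nat.lt_succ_r, INR_lt; rewrite S_INR.
  assert (grid n (index n s) < grid n (index n t) + / INR n) by lra.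
  unfold grid in *.
  apply Rmult_lt_reg_r with (/ INR n); [apply Rinv_0_lt_compat, HnR|].
  unfold Rdiv in *; lra.
Qed.

Lemma grid_shift (n i k : nat) : (0 < n)%nat ->
  grid n (i + k) = grid n i + INR k / INR n.
Proof.
  intros Hn; unfold grid; rewrite plus_INR; field; apply not_0_INR; lia.
Qed.

Lemma eventually_large (r : R) : eventually (fun n => r <= INR n).
Proof.
  destruct (nfloor_ex (Rmax r 0) (Rmax_r _ _)) as [N HN].
  exists (S N); intros n Hn; apply le_INR in Hn; rewrite S_INR in Hn.
  pose proof (Rmax_l r 0); lra.
Qed.

Lemma eventually_inv_small (r : R) : 0 < r -> eventually (fun n => (0 < n)%nat /\ / INR n < r).
Proof.
  intros Hr; destruct (eventually_large (/ r + 1)) as [N HN].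
  exists N; intros n Hn; specialize (HN n Hn).
  assert (0 < / r) by (apply Rinv_0_lt_compat, Hr).
  split; [apply INR_lt; simpl; lra|].
  rewrite <- (Rinv_inv r); apply Rinv_lt_contravar; [|lra].
  apply Rmult_lt_0_compat; lra.
Qed.

(** * Limit position and velocity, and their differential equations *)

Section Limit.
Context (U : (nat -> Prop) -> Prop) (HU : free_ultrafilter U).
Context (V A : R -> R) (HV : C2 V) (HV0 : forall x, 0 <= V x) (HA0 : forall t, 0 <= A t).
Context (HA : forall t, continuous A t) (C : R) (HC : 0 < C).
Context (y : nat -> nat -> R).
Context (Hy : forall n, (0 < n)%nat -> discrete_heteroclinic V A C n (y n)).
Context (x v : R -> R).
Context (Hx : forall t, filterlim (fun n => y n (index n t)) U (locally (x t))).

#[local] Instance U_proper : ProperFilter U := fu_proper U HU.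

Lemma y_bounds (n i : nat) : (0 < n)%nat -> -1 <= y n i <= 1.
Proof. intros Hn; apply (dh_adm _ _ _ _ _ (Hy n Hn)). Qed.

Lemma U_large (r : R) : U (fun n => r <= INR n).
Proof. apply (fu_eventually U HU), eventually_large. Qed.

Lemma U_inv_small (r : R) : 0 < r -> U (fun n => (0 < n)%nat /\ / INR n < r).
Proof. intros Hr; apply (fu_eventually U HU), eventually_inv_small, Hr. Qed.

Lemma grid_index_limit (t : R) : filterlim (fun n => grid n (index n t)) U (locally t).
Proof.
  apply filterlim_locally; intros e.
  apply filter_imp with (2 := filter_and _ _ (U_large (Rabs t)) (U_inv_small e (cond_pos e))).
  intros n [H1 [H2 H3]].
  destruct (index_spec n t H2 H1).
  apply Rabs_def1; unfold minus, plus, opp; simpl; lra.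
Qed.

Lemma x_bounds (t : R) : -1 <= x t <= 1.
Proof.
  split.
  - apply (filterlim_le_R (F := U) (fun _ => -1) (fun n => y n (index n t)));
      [|apply filterlim_const|apply Hx].
    apply filter_imp with (2 := U_large 1); intros n Hn.
    apply y_bounds, INR_lt; simpl; lra.
  - apply (filterlim_le_R (F := U) (fun n => y n (index n t)) (fun _ => 1));
      [|apply Hx|apply filterlim_const].
    apply filter_imp with (2 := U_large 1); intros n Hn.
    apply y_bounds, INR_lt; simpl; lra.
Qed.

Lemma derive_V_continuous (z : R) : continuous (Derive V) z.
Proof. apply (ex_derive_continuous (V := R_NormedModule)), HV. Qed.

Lemma force_bounded (r : R) : 0 <= r ->
  exists M, 0 < M /\ forall s z, - r <= s <= r -> -1 <= z <= 1 -> Rabs (A s * Derive V z) <= M.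
Proof.
  intros Hr.
  destruct (continuous_bounded A r HA Hr) as [M1 [HM1 H1]].
  destruct (continuous_bounded (Derive V) 1 derive_V_continuous ltac:(lra)) as [M2 [HM2 H2]].
  exists (M1 * M2); split; [apply Rmult_lt_0_compat; assumption|].
  intros s z Hs Hz; rewrite Rabs_mult.
  apply Rmult_le_compat; try apply Rabs_pos; auto.
Qed.

Lemma grid_velocity_lipschitz (r M : R) (n i k : nat) : (0 < n)%nat ->
  (forall s z, - r <= s <= r -> -1 <= z <= 1 -> Rabs (A s * Derive V z) <= M) ->
  (i + k < 2 * n * n)%nat -> - r <= grid n i -> grid n (i + k) <= r ->
  Rabs (velocity n (y n) (i + k) - velocity n (y n) i) <= INR k / INR n * M.
Proof.
  intros Hn HM Hk Hl Hr.
  pose proof (velocity_increment V A C n (y n) 0 M i k Hn (Hy n Hn) Hk) as H.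
  rewrite Rmult_0_r, Rminus_0_r in H; apply H.
  intros p Hp; rewrite Rminus_0_r; apply HM; [|apply y_bounds, Hn].
  pose proof (grid_le n i p Hn ltac:(lia)); pose proof (grid_le n p (i + k) Hn ltac:(lia)).
  lra.
Qed.

Lemma grid_position_taylor (r M : R) (n i k : nat) : (0 < n)%nat -> 0 <= M ->
  (forall s z, - r <= s <= r -> -1 <= z <= 1 -> Rabs (A s * Derive V z) <= M) ->
  (i + k <= 2 * n * n)%nat -> - r <= grid n i -> grid n (i + k) <= r ->
  Rabs (y n (i + k)%nat - y n i - INR k / INR n * velocity n (y n) i)
    <= M * (INR k / INR n) ^ 2.
Proof.
  intros Hn HM0 HM Hk Hl Hr.
  apply position_increment; [exact Hn|exact HM0|].
  intros p Hp; apply (grid_velocity_lipschitz r); auto; [lia|].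
  apply Rle_trans with (2 := Hr), grid_le; [exact Hn|lia].
Qed.

(** Over the [n] steps of a unit time the position changes by at most [2], while the Taylor error is
    at most [M]; the initial velocity is thus at most [2 + M] in absolute value. *)
Lemma grid_velocity_bounded (t : R) :
  exists B, U (fun n => Rabs (velocity n (y n) (index n t)) <= B).
Proof.
  pose proof (Rabs_pos t) as Ht0.
  destruct (force_bounded (Rabs t + 2) ltac:(lra)) as [M [HM0 HM]].
  exists (2 + M).
  apply filter_imp with (2 := U_large (Rabs t + 2)); intros n Hn.
  assert (Hn0 : (0 < n)%nat) by (apply INR_lt; simpl; lra).
  assert (HnR : 0 < INR n) by lra.
  destruct (index_spec n t Hn0 ltac:(lra)) as [H1 H2].
  assert (Hin : / INR n <= 1) by (rewrite <- Rinv_1; apply Rinv_le_contravar; lra).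
  pose proof (proj1 (Rabs_le_between t _) (Rle_refl _)) as Ht.
  pose proof (grid_position_taylor (Rabs t + 2) M n (index n t) n Hn0 ltac:(lra) HM
    (index_range n t Hn)) as H.
  rewrite grid_shift in H by exact Hn0.
  replace (INR n / INR n) with 1 in H by (field; lra).
  specialize (H ltac:(lra) ltac:(lra)).
  pose proof (y_bounds n (index n t) Hn0); pose proof (y_bounds n (index n t + n) Hn0).
  apply Rabs_le_between in H; apply Rabs_le_between; lra.
Qed.

Context (Hv : forall t, filterlim (fun n => velocity n (y n) (index n t)) U (locally (v t))).

(** The elapsed time [k / n] is expressed as a difference of grid points because that difference has
    ultralimit [t - s], whereas [k] varies with [n]. *)
Lemma index_window (s t : R) : s <= t ->
  U (fun n => (0 < n)%nat /\ exists k, index n t = (index n s + k)%nat /\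
       INR k / INR n = grid n (index n t) - grid n (index n s) /\
       (index n t < 2 * n * n)%nat /\
       s - / INR n <= grid n (index n s) /\ grid n (index n t) <= t).
Proof.
  intros Hst.
  apply filter_imp with (2 := filter_and _ _ (U_large (Rabs s + 2)) (U_large (Rabs t + 2))).
  intros n [H1 H2].
  pose proof (Rabs_pos s); pose proof (Rabs_pos t).
  assert (Hn : (0 < n)%nat) by (apply INR_lt; simpl; lra).
  pose proof (index_le n s t Hn ltac:(lra) ltac:(lra) Hst) as Hle.
  pose proof (index_range n t H2).
  destruct (index_spec n s Hn ltac:(lra)); destruct (index_spec n t Hn ltac:(lra)).
  split; [exact Hn|].
  exists (index n t - index n s)%nat.
  assert (E : index n t = (index n s + (index n t - index n s))%nat) by lia.
  repeat split; try lra; try lia.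
  pose proof (grid_shift n (index n s) (index n t - index n s) Hn) as Hg.
  rewrite <- E in Hg; lra.
Qed.

Lemma velocity_limit_increment (s t g e : R) : s <= t ->
  U (fun n => forall p, (index n s < p <= index n t)%nat ->
       Rabs (A (grid n p) * Derive V (y n p) - g) <= e) ->
  Rabs (v t - v s - (t - s) * g) <= (t - s) * e.
Proof.
  intros Hst HUe.
  apply (filterlim_le_R (F := U)
    (fun n => Rabs (velocity n (y n) (index n t) - velocity n (y n) (index n s)
                    - (grid n (index n t) - grid n (index n s)) * g))
    (fun n => (grid n (index n t) - grid n (index n s)) * e)).
  - apply filter_imp with (2 := filter_and _ _ (index_window s t Hst) HUe).
    intros n [[Hn [k [E [<- [Hk _]]]]] Hp].
    rewrite E in *. apply (velocity_increment V A C); auto.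
  - apply filterlim_Rabs_R, filterlim_minus_R; [apply filterlim_minus_R; apply Hv|].
    apply filterlim_mult_R; [|apply filterlim_const].
    apply filterlim_minus_R; apply grid_index_limit.
  - apply filterlim_mult_R; [|apply filterlim_const].
    apply filterlim_minus_R; apply grid_index_limit.
Qed.

(** The force bound is required on a radius larger by [1], since the node of [s] may lie to the left
    of [s] by up to [/ INR n]. *)
Lemma velocity_limit_lipschitz (r M s t : R) :
  (forall q z, - (r + 1) <= q <= r + 1 -> -1 <= z <= 1 -> Rabs (A q * Derive V z) <= M) ->
  - r <= s -> s <= t -> t <= r -> Rabs (v t - v s) <= (t - s) * M.
Proof.
  intros HM Hs Hst Ht.
  pose proof (velocity_limit_increment s t 0 M Hst) as H.
  rewrite Rmult_0_r, Rminus_0_r in H; apply H.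
  apply filter_imp with (2 := filter_and _ _ (index_window s t Hst) (U_inv_small 1 Rlt_0_1)).
  intros n [[Hn [k [_ [_ [_ [H1 H2]]]]]] [_ H3]] p Hp.
  rewrite Rminus_0_r; apply HM; [|apply y_bounds, Hn].
  pose proof (grid_le n (index n s) p Hn ltac:(lia)).
  pose proof (grid_le n p (index n t) Hn ltac:(lia)). lra.
Qed.

Lemma position_limit_taylor (r M s t : R) : 0 <= M ->
  (forall q z, - (r + 1) <= q <= r + 1 -> -1 <= z <= 1 -> Rabs (A q * Derive V z) <= M) ->
  - r <= s -> s <= t -> t <= r -> Rabs (x t - x s - (t - s) * v s) <= M * (t - s) ^ 2.
Proof.
  intros HM0 HM Hs Hst Ht.
  apply (filterlim_le_R (F := U)
    (fun n => Rabs (y n (index n t) - y n (index n s)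
       - (grid n (index n t) - grid n (index n s)) * velocity n (y n) (index n s)))
    (fun n => M * (grid n (index n t) - grid n (index n s)) ^ 2)).
  - apply filter_imp with (2 := filter_and _ _ (index_window s t Hst) (U_inv_small 1 Rlt_0_1)).
    intros n [[Hn [k [E [<- [Hk [H1 H2]]]]]] [_ H3]].
    rewrite E in *; apply (grid_position_taylor (r + 1)); auto; [lia|lra|lra].
  - apply filterlim_Rabs_R, filterlim_minus_R; [apply filterlim_minus_R; apply Hx|].
    apply filterlim_mult_R; [|apply Hv].
    apply filterlim_minus_R; apply grid_index_limit.
  - apply filterlim_mult_R; [apply filterlim_const|].
    assert (Hg : filterlim (fun n => grid n (index n t) - grid n (index n s)) U
                   (locally (t - s))) by (apply filterlim_minus_R; apply grid_index_limit).
    simpl; repeat apply filterlim_mult_R; try exact Hg; apply filterlim_const.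
Qed.

Lemma limit_derive_position (t : R) : is_derive x t (v t).
Proof.
  apply is_derive_intro; intros e He.
  pose proof (Rabs_pos t) as Ht0.
  pose proof (proj1 (Rabs_le_between t _) (Rle_refl _)) as Ht.
  set (r := Rabs t + 1) in *.
  destruct (force_bounded (r + 1) ltac:(unfold r; lra)) as [M [HM0 HM]].
  exists (Rmin 1 (e / (2 * M))).
  assert (0 < e / (2 * M)) by (apply Rdiv_lt_0_compat; lra).
  split; [apply Rmin_pos; lra|].
  intros s Hs.
  assert (H1 : Rabs (s - t) < 1) by (apply Rlt_le_trans with (1 := Hs), Rmin_l).
  assert (H2 : 2 * M * Rabs (s - t) <= e).
  { replace e with (2 * M * (e / (2 * M))) by (field; lra).
    apply Rmult_le_compat_l; [lra|].
    apply Rlt_le, Rlt_le_trans with (1 := Hs), Rmin_r. }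
  pose proof (Rabs_def2 _ _ H1) as H3.
  apply Rle_trans with (2 * M * Rabs (s - t) * Rabs (s - t));
    [|apply Rmult_le_compat_r; [apply Rabs_pos|exact H2]].
  rewrite Rmult_assoc, <- Rabs_mult, (Rabs_pos_eq ((s - t) * (s - t))) by apply Rle_0_sqr.
  assert (0 <= (s - t) * (s - t)) by apply Rle_0_sqr.
  destruct (Rle_lt_dec t s) as [Hle|Hlt].
  - pose proof (position_limit_taylor r M t s ltac:(lra) HM
      ltac:(unfold r; lra) Hle ltac:(unfold r; lra)) as H4.
    apply Rle_trans with (1 := H4); nra.
  (* The Taylor estimate looks forward only. For [s < t] it is based at [s], and exchanging [v s]
     for [v t] costs another [M * (t - s) ^ 2]; hence the factor [2] in [e / (2 * M)]. *)
  - pose proof (position_limit_taylor r M s t ltac:(lra) HM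
      ltac:(unfold r; lra) ltac:(lra) ltac:(unfold r; lra)) as H4.
    pose proof (velocity_limit_lipschitz r M s t HM
      ltac:(unfold r; lra) ltac:(lra) ltac:(unfold r; lra)) as H5.
    replace (x s - x t - (s - t) * v t)
      with (- (x t - x s - (t - s) * v s) + (t - s) * (v t - v s)) by ring.
    apply Rle_trans with (1 := Rabs_triang _ _).
    rewrite Rabs_Ropp, Rabs_mult, (Rabs_pos_eq (t - s)) by lra.
    apply (Rmult_le_compat_l (t - s)) in H5; nra.
Qed.

(** Pointwise convergence at [t] alone gives closeness at all nodes near [t], because the Hölder
    estimate is uniform in [n]. *)
Lemma force_near_limit (t e : R) : 0 < e ->
  exists d, 0 < d /\ U (fun n => forall p, (p <= 2 * n * n)%nat ->
    Rabs (grid n p - t) <= 2 * d ->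
    Rabs (A (grid n p) * Derive V (y n p) - A t * Derive V (x t)) <= e).
Proof.
  intros He.
  destruct (continuous_bounded (Derive V) 1 derive_V_continuous ltac:(lra)) as [G [HG0 HG]].
  pose proof (Rabs_pos (A t)) as HAt.
  set (h := e / (G + Rabs (A t))).
  assert (Hh : 0 < h) by (apply Rdiv_lt_0_compat; lra).
  destruct (proj1 (filterlim_locally A (A t)) (HA t) (mkposreal h Hh)) as [d1 Hd1].
  destruct (proj1 (filterlim_locally (Derive V) (Derive V (x t)))
    (derive_V_continuous (x t)) (mkposreal h Hh)) as [d2 Hd2].
  pose proof (cond_pos d1) as Hd1p; pose proof (cond_pos d2) as Hd2p.
  (* A node within [2 * d] of [t] is within [3 * d] of the node of [t], so the squared increment is
     at most [6 * C * d], below [(d2 / 2) ^ 2]. The other half of [d2] covers the convergence at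
     [t]. *)
  set (d := Rmin (d1 / 4) ((d2 / 2) ^ 2 / (8 * C))).
  assert (HdC : 0 < (d2 / 2) ^ 2 / (8 * C)) by (apply Rdiv_lt_0_compat; [apply pow_lt|]; lra).
  assert (Hd : 0 < d) by (apply Rmin_pos; lra).
  assert (Hdl : d <= d1 / 4) by apply Rmin_l.
  assert (Hdr : 8 * C * d <= (d2 / 2) ^ 2).
  { replace ((d2 / 2) ^ 2) with (8 * C * ((d2 / 2) ^ 2 / (8 * C))) by (field; lra).
    apply Rmult_le_compat_l; [lra|apply Rmin_r]. }
  exists d; split; [exact Hd|].
  assert (Hd2h : 0 < d2 / 2) by lra.
  apply filter_imp with (2 := filter_and _ _
    (filter_and _ _ (U_large (Rabs t + 2)) (U_inv_small d Hd))
    (proj1 (filterlim_locally _ _) (Hx t) (mkposreal _ Hd2h))).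
  intros n [[Hn [Hn0 Hin]] Hball] p Hp Hpt.
  pose proof (Rabs_pos t).
  assert (HnR : 0 < INR n) by (apply lt_0_INR, Hn0).
  destruct (index_spec n t Hn0 ltac:(lra)) as [H1 H2].
  pose proof (index_range n t Hn) as H3.
  pose proof (proj1 (Rabs_le_between _ _) Hpt) as Hpt'.
  set (i := index n t) in *.
  assert (Hinc : (y n p - y n i) ^ 2 <= (d2 / 2) ^ 2).
  { apply Rle_trans with (2 := Hdr).
    destruct (le_lt_dec i p) as [Hle|Hlt].
    - pose proof (window_increment V A C n (y n) HV0 HA0 Hn0 (Hy n Hn0) i (p - i)%nat
        ltac:(lia)) as H4.
      replace (i + (p - i))%nat with p in H4 by lia.
      pose proof (grid_shift n i (p - i) Hn0) as H5.
      replace (i + (p - i))%nat with p in H5 by lia.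
      replace (INR (p - i) * (2 * C / INR n)) with (2 * C * (INR (p - i) / INR n)) in H4
        by (field; lra).
      nra.
    - pose proof (window_increment V A C n (y n) HV0 HA0 Hn0 (Hy n Hn0) p (i - p)%nat
        ltac:(lia)) as H4.
      replace (p + (i - p))%nat with i in H4 by lia.
      pose proof (grid_shift n p (i - p) Hn0) as H5.
      replace (p + (i - p))%nat with i in H5 by lia.
      replace (INR (i - p) * (2 * C / INR n)) with (2 * C * (INR (i - p) / INR n)) in H4
        by (field; lra).
      nra. }
  assert (Hyi : Rabs (y n i - x t) < d2 / 2) by exact Hball.
  assert (Hyp : Rabs (y n p - x t) < d2).
  { replace (y n p - x t) with ((y n p - y n i) + (y n i - x t)) by ring.
    apply Rle_lt_trans with (1 := Rabs_triang _ _).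
    assert (Rabs (y n p - y n i) <= d2 / 2).
    { apply Rabs_le_between; split; apply Rnot_lt_le; intros Hc; nra. }
    lra. }
  assert (HAp : Rabs (A (grid n p) - A t) < h).
  { apply (Hd1 (grid n p)); change (Rabs (grid n p - t) < d1); lra. }
  assert (HVp : Rabs (Derive V (y n p) - Derive V (x t)) < h) by (apply (Hd2 (y n p)); exact Hyp).
  replace (A (grid n p) * Derive V (y n p) - A t * Derive V (x t))
    with ((A (grid n p) - A t) * Derive V (y n p)
          + A t * (Derive V (y n p) - Derive V (x t))) by ring.
  apply Rle_trans with (1 := Rabs_triang _ _); rewrite !Rabs_mult.
  replace e with (h * G + Rabs (A t) * h) by (unfold h; field; lra).
  apply Rplus_le_compat.
  - apply Rmult_le_compat; try apply Rabs_pos; [lra|apply HG, y_bounds, Hn0].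
  - apply Rmult_le_compat_l; [exact HAt|lra].
Qed.

Lemma limit_derive_velocity (t : R) : is_derive v t (A t * Derive V (x t)).
Proof.
  apply is_derive_intro; intros e He.
  destruct (force_near_limit t e He) as [d [Hd HUd]].
  exists d; split; [exact Hd|].
  intros s Hs; pose proof (Rabs_def2 _ _ Hs) as Hs'.
  set (g := A t * Derive V (x t)) in *.
  (* Rounding [a] to the grid costs less than [d], which the radius [2 * d] of [force_near_limit]
     absorbs. *)
  assert (Hnear : forall a b, a <= b -> t - d < a -> b < t + d ->
    U (fun n => forall p, (index n a < p <= index n b)%nat ->
         Rabs (A (grid n p) * Derive V (y n p) - g) <= e)).
  { intros a b Hab Ha Hb.
    apply filter_imp with (2 := filter_and _ _ HUd
      (filter_and _ _ (index_window a b Hab) (U_inv_small d Hd))).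
    intros n [H1 [[Hn [k [_ [_ [H2 [H3 H4]]]]]] [_ H5]]] p Hp.
    apply H1; [lia|].
    pose proof (grid_le n (index n a) p Hn ltac:(lia)).
    pose proof (grid_le n p (index n b) Hn ltac:(lia)).
    apply Rabs_le_between; lra. }
  destruct (Rle_lt_dec t s) as [Hle|Hlt].
  - rewrite (Rabs_pos_eq (s - t)), (Rmult_comm e) by lra.
    apply velocity_limit_increment; [exact Hle|apply Hnear; lra].
  - rewrite (Rabs_left (s - t)) by lra.
    replace (v s - v t - (s - t) * g) with (- (v t - v s - (t - s) * g)) by ring.
    rewrite Rabs_Ropp; replace (e * - (s - t)) with ((t - s) * e) by ring.
    apply velocity_limit_increment; [lra|apply Hnear; lra].
Qed.

Lemma limit_tails (d : R) : (forall z, -1 < z < 1 -> 0 < V z) ->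
  is_lim A p_infty p_infty -> is_lim A m_infty p_infty -> 0 < d < 1 ->
  exists L, forall t, (L < t -> 1 - d <= x t) /\ (t < - L -> x t <= -1 + d).
Proof.
  intros HVpos Hp Hm Hd.
  destruct (discrete_heteroclinic_tails V A C d) as [L [n0 HL]]; auto.
  { intros z; apply (ex_derive_continuous (V := R_NormedModule)), HV. }
  (* The node of [t] may lie below [t] by less than [1], hence the shift of [L]. *)
  exists (L + 1); intros t.
  assert (Hn0 : U (fun n => (n0 <= n)%nat)) by (apply (fu_eventually U HU); exists n0; auto).
  assert (Ht : U (fun n => (L + 1 < t -> 1 - d <= y n (index n t)) /\
                           (t < - (L + 1) -> y n (index n t) <= -1 + d))).
  { apply filter_imp with (2 := filter_and _ _ Hn0
      (filter_and _ _ (U_large (Rabs t + 2)) (U_inv_small 1 Rlt_0_1))).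
    intros n [H1 [H2 [H3 H4]]].
    pose proof (index_range n t H2).
    destruct (index_spec n t H3) as [H5 H6]; [lra|].
    destruct (HL n (y n) H1 (Hy n H3) (index n t) ltac:(lia)) as [H7 H8].
    split; intros Ht; [apply H7|apply H8]; lra. }
  split; intros Hlt.
  - apply (filterlim_le_R (F := U) (fun _ => 1 - d) (fun n => y n (index n t)));
      [|apply filterlim_const|apply Hx].
    apply filter_imp with (2 := Ht); intros n [H _]; auto.
  - apply (filterlim_le_R (F := U) (fun n => y n (index n t)) (fun _ => -1 + d));
      [|apply Hx|apply filterlim_const].
    apply filter_imp with (2 := Ht); intros n [_ H]; auto.
Qed.

End Limit.

(** * Strict bounds and conclusion *)

(** The integrating factor [exp (q * s)], with [q = - L] forward and [q = L] backward in time, keeps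
    the product [g] from rising between [t0] and [t]. So [g t <= 0], and [E] is nonnegative. *)
Lemma gronwall_zero (E dE : R -> R) (L t0 t : R) :
  (forall s, is_derive E s (dE s)) -> (forall s, 0 <= E s) -> E t0 = 0 ->
  (forall s, Rmin t0 t <= s <= Rmax t0 t -> Rabs (dE s) <= L * E s) -> E t = 0.
Proof.
  intros HE HE0 Ht0 HL.
  set (q := if Rle_dec t0 t then - L else L).
  set (g := fun s => E s * exp (q * s)).
  set (dg := fun s => (dE s + q * E s) * exp (q * s)).
  assert (Hg : forall s, is_derive g s (dg s)).
  { intros s; unfold g, dg; auto_derive; [exists (dE s); apply HE|].
    replace (Derive (fun x => E x) s) with (dE s)
      by (symmetry; apply is_derive_unique, HE). ring. }
  destruct (MVT_gen g t0 t dg) as [c [Hc Hgc]].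
  - intros s _; apply Hg.
  - intros s _; apply continuity_pt_filterlim.
    apply (ex_derive_continuous (V := R_NormedModule)); exists (dg s); apply Hg.
  - specialize (HL c Hc); apply Rabs_le_between in HL.
    pose proof (exp_pos (q * c)); pose proof (exp_pos (q * t)).
    assert (Hle : g t <= 0).
    { assert (g t0 = 0) by (unfold g; rewrite Ht0; ring).
      enough (dg c * (t - t0) <= 0) by lra.
      unfold dg, q in *; destruct (Rle_dec t0 t) as [Hle|Hle].
      - assert (0 <= - (dE c + - L * E c) * exp (- L * c)) by (apply Rmult_le_pos; lra).
        nra.
      - assert (0 <= (dE c + L * E c) * exp (L * c)) by (apply Rmult_le_pos; lra).
        nra. }
    specialize (HE0 t); unfold g in Hle; nra.
Qed.

Lemma derive_lipschitz (V : R -> R) : C2 V ->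
  exists K, 0 < K /\ forall a b, -1 <= a <= 1 -> -1 <= b <= 1 ->
    Rabs (Derive V b - Derive V a) <= K * Rabs (b - a).
Proof.
  intros HV.
  destruct (continuous_bounded (Derive (Derive V)) 1) as [K [HK0 HK]];
    [intros z; apply HV|lra|].
  exists K; split; [exact HK0|]; intros a b Ha Hb.
  destruct (MVT_gen (Derive V) a b (Derive (Derive V))) as [c [Hc E]].
  - intros z _; apply Derive_correct, HV.
  - intros z _; apply continuity_pt_filterlim.
    apply (ex_derive_continuous (V := R_NormedModule)), HV.
  - rewrite E, Rabs_mult; apply Rmult_le_compat_r; [apply Rabs_pos|].
    apply HK; revert Hc; unfold Rmin, Rmax; destruct (Rle_dec a b); lra.
Qed.

(* [c] is an equilibrium and [x' = 0] at the contact point, so uniqueness for the Cauchy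
   problem makes [x] constant. *)
Lemma touching_constant (V A x v : R -> R) (c t0 : R) :
  C2 V -> (forall t, continuous A t) ->
  (forall t, is_derive x t (v t)) -> (forall t, is_derive v t (A t * Derive V (x t))) ->
  (forall t, -1 <= x t <= 1) -> c = 1 \/ c = -1 -> Derive V c = 0 -> x t0 = c ->
  forall t, x t = c.
Proof.
  intros HV HA Hx Hv Hb Hc HVc Hx0 t.
  destruct (derive_lipschitz V HV) as [K [HK0 HK]].
  set (r := Rmax (Rabs t0) (Rabs t)).
  pose proof (Rabs_pos t0) as Hp0.
  assert (Hr1 : Rabs t0 <= r) by apply Rmax_l.
  assert (Hr2 : Rabs t <= r) by apply Rmax_r.
  destruct (continuous_bounded A r HA ltac:(lra)) as [M [HM0 HM]].
  assert (Hcc : c * c = 1) by (destruct Hc as [-> | ->]; ring).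
  (* As [c] is [1] or [-1], the function [- c * x] is minimal at [t0] in either case; its derivative
     there vanishes. *)
  assert (Hmin : forall s, - c * x t0 <= - c * x s).
  { intros s; rewrite Hx0; specialize (Hb s); destruct Hc as [-> | ->]; lra. }
  assert (Hcx : is_derive (fun s => - c * x s) t0 (- c * v t0))
    by (apply is_derive_scal, Hx).
  assert (Hv0 : v t0 = 0).
  { pose proof (derive_ge_0_of_right_min _ _ _ 1 Hcx Rlt_0_1 (fun s _ => Hmin s)).
    pose proof (derive_le_0_of_left_min _ _ _ 1 Hcx Rlt_0_1 (fun s _ => Hmin s)).
    destruct Hc as [-> | ->]; lra. }
  (* [E] is the squared phase-plane distance to the equilibrium. With [M] bounding [A] and [K] a
     Lipschitz constant of [V'], [2 a b <= a^2 + b^2] gives the rate [1 + M * K]. *)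
  set (E := fun s => (x s - c) ^ 2 + v s ^ 2).
  set (dE := fun s => 2 * (x s - c) * v s + 2 * v s * (A s * Derive V (x s))).
  enough (H : E t = 0).
  { unfold E in H; pose proof (pow2_ge_0 (v t)); pose proof (pow2_ge_0 (x t - c)).
    assert (x t - c = 0) by (apply Rsqr_0_uniq; unfold Rsqr; lra). lra. }
  apply (gronwall_zero E dE (1 + M * K) t0 t).
  - intros s; unfold E, dE; auto_derive.
    + split; [exists (v s); apply Hx|split; [|exact I]].
      exists (A s * Derive V (x s)); apply Hv.
    + replace (Derive (fun x0 => x x0) s) with (v s)
        by (symmetry; apply is_derive_unique, Hx).
      replace (Derive (fun x0 => v x0) s) with (A s * Derive V (x s))
        by (symmetry; apply is_derive_unique, Hv).
      ring.
  - intros s; unfold E; pose proof (pow2_ge_0 (v s)); pose proof (pow2_ge_0 (x s - c)); lra.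
  - unfold E; rewrite Hx0, Hv0; ring.
  - intros s Hs.
    assert (Hsr : - r <= s <= r).
    { apply Rabs_le_between in Hr1, Hr2.
      revert Hs; unfold Rmin, Rmax; destruct (Rle_dec t0 t); lra. }
    assert (HF : Rabs (A s * Derive V (x s)) <= M * K * Rabs (x s - c)).
    { rewrite Rabs_mult, Rmult_assoc.
      apply Rmult_le_compat; try apply Rabs_pos; [apply HM, Hsr|].
      specialize (HK c (x s) ltac:(destruct Hc; lra) (Hb s)).
      now rewrite HVc, Rminus_0_r in HK. }
    unfold dE, E.
    apply Rle_trans with (1 := Rabs_triang _ _).
    rewrite !Rabs_mult, (Rabs_pos_eq 2), <- (pow2_abs (x s - c)), <- (pow2_abs (v s)) by lra.
    rewrite Rabs_mult in HF.
    set (F := Rabs (A s) * Rabs (Derive V (x s))) in *.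
    pose proof (Rabs_pos (x s - c)); pose proof (Rabs_pos (v s)).
    set (a := Rabs (x s - c)) in *; set (b := Rabs (v s)) in *.
    assert (Hab : 2 * a * b <= a ^ 2 + b ^ 2) by (pose proof (pow2_ge_0 (a - b)); lra).
    assert (HbF : 2 * b * F <= 2 * b * (M * K * a)) by (apply Rmult_le_compat_l; lra).
    assert (HMK : M * K * (2 * a * b) <= M * K * (a ^ 2 + b ^ 2)).
    { apply Rmult_le_compat_l; [apply Rmult_le_pos; lra|exact Hab]. }
    lra.
Qed.

Lemma derive_zero_of_min (V : R -> R) (c : R) :
  ex_derive V c -> (forall z, V c <= V z) -> Derive V c = 0.
Proof.
  intros HV Hmin; apply Derive_correct in HV; apply Rle_antisym.
  - apply (derive_le_0_of_left_min V c _ 1 HV Rlt_0_1); auto.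
  - apply (derive_ge_0_of_right_min V c _ 1 HV Rlt_0_1); auto.
Qed.

(** Only the weak bounds on [x] pass to the limit; strictness is obtained afterwards from the
    differential equation. *)
Lemma heteroclinic_exists (V A : R -> R) :
  C2 V -> (forall z, 0 <= V z) -> V (-1) = 0 -> V 1 = 0 ->
  (forall z, -1 < z < 1 -> 0 < V z) ->
  (forall t, continuous A t) -> (forall t, 0 <= A t) ->
  is_lim A p_infty p_infty -> is_lim A m_infty p_infty ->
  exists x v : R -> R,
    (forall t, is_derive x t (v t)) /\ (forall t, is_derive v t (A t * Derive V (x t))) /\
    (forall t, -1 <= x t <= 1) /\
    forall d, 0 < d < 1 ->
      exists L, forall t, (L < t -> 1 - d <= x t) /\ (t < - L -> x t <= -1 + d).
Proof.
  intros HV HV0 Hm1 H1 HVpos HA HA0 Hp Hm.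
  assert (HVc : forall z, continuous V z).
  { intros z; apply (ex_derive_continuous (V := R_NormedModule)), HV. }
  destruct (continuous_bounded A 1 HA ltac:(lra)) as [K1 [HK1 HA1]].
  destruct (continuous_bounded V 1 HVc ltac:(lra)) as [K2 [HK2 HV1]].
  set (K := K1 * K2).
  assert (HK0 : 0 < K) by (apply Rmult_lt_0_compat; assumption).
  assert (HK : forall t s, -1 <= t <= 1 -> -1 <= s <= 1 -> A t * V s <= K).
  { intros t s Ht Hs; specialize (HA1 t Ht); specialize (HV1 s Hs).
    apply Rabs_le_between in HA1, HV1; apply Rmult_le_compat; auto; lra. }
  assert (Hd1 : Derive V 1 = 0)
    by (apply derive_zero_of_min; [apply HV|rewrite H1; exact HV0]).
  assert (Hdm1 : Derive V (-1) = 0)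
    by (apply derive_zero_of_min; [apply HV|rewrite Hm1; exact HV0]).
  set (C := 1 + 2 * K).
  assert (HC : 0 < C) by (unfold C; lra).
  (* Positivity of [n] sits inside the existential so that choice applies over all [n], with a dummy
     sequence at [0]. *)
  assert (Hex : forall n, exists y, (0 < n)%nat -> discrete_heteroclinic V A C n y).
  { intros n; destruct (Nat.eq_dec n 0) as [->|Hn]; [exists (fun _ => 0); lia|].
    destruct (discrete_heteroclinic_exists V A K n) as [y Hy]; auto; [lia|].
    exists y; auto. }
  destruct (functional_choice _ Hex) as [y Hy].
  (* A single ultrafilter provides the limits at all real times simultaneously, without extraction
     of subsequences. *)
  destruct free_ultrafilter_exists as [U HU].
  assert (Hxe : forall t, exists l : R, filterlim (fun n => y n (index n t)) U (locally l)).
  { intros t; apply ultralimit_exists with 1; [exact HU|].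
    apply (fu_eventually U HU); exists 1%nat; intros n Hn.
    apply Rabs_le_between, (dh_adm _ _ _ _ _ (Hy n Hn)). }
  assert (Hve : forall t, exists l : R,
    filterlim (fun n => velocity n (y n) (index n t)) U (locally l)).
  { intros t.
    destruct (grid_velocity_bounded U HU V A HV HA C y Hy t) as [B HB].
    apply ultralimit_exists with B; assumption. }
  destruct (functional_choice _ Hxe) as [x Hx]; destruct (functional_choice _ Hve) as [v Hv].
  exists x, v; split; [|split; [|split]]; intros t.
  - exact (limit_derive_position U HU V A HV HA C y Hy x v Hx Hv t).
  - exact (limit_derive_velocity U HU V A HV HV0 HA0 HA C HC y Hy x v Hx Hv t).
  - exact (x_bounds U HU V A C y Hy x Hx t).
  - exact (limit_tails U HU V A HV HV0 HA0 C HC y Hy x Hx t HVpos Hp Hm).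
Qed.

Theorem theorem5p1
  (V a : R -> R)
  (HV : C2 V)
  (HVnonneg : forall x : R, 0 <= V x)
  (HVm1 : V (-1) = 0) (HV1 : V 1 = 0)
  (HVpos : forall x : R, -1 < x < 1 -> 0 < V x)
  (HV2m1 : Derive (Derive V) (-1) > 0) (HV21 : Derive (Derive V) 1 > 0)
  (Ha_cont : forall t : R, continuous a t)
  (Ha_inf : exists m : R, 0 < m /\ forall t : R, m <= a t)
  (Ha_pinf : is_lim a p_infty p_infty)
  (Ha_minf : is_lim a m_infty p_infty) :
  forall eps : R, 0 < eps ->
    exists x : R -> R,
      C2 x /\
      (forall t : R, Derive (Derive x) t = a (eps * t) * Derive V (x t)) /\
      is_lim x m_infty (-1) /\
      is_lim x p_infty 1 /\
      (forall t : R, -1 < x t < 1).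
Proof.
  intros eps Heps.
  set (A := fun t => a (eps * t)).
  assert (HA : forall t, continuous A t).
  { intros t; apply (continuous_comp (fun s => eps * s) a); [|apply Ha_cont].
    apply (ex_derive_continuous (V := R_NormedModule)); auto_derive; exact I. }
  assert (HAp : is_lim A p_infty p_infty).
  { apply is_lim_spec; intros B.
    destruct (proj2 (is_lim_spec a p_infty p_infty) Ha_pinf B) as [L HL].
    exists (L / eps); intros t Ht; apply HL.
    apply (Rmult_lt_compat_l eps) in Ht; [|exact Heps].
    now replace (eps * (L / eps)) with L in Ht by (field; lra). }
  assert (HAm : is_lim A m_infty p_infty).
  { apply is_lim_spec; intros B.
    destruct (proj2 (is_lim_spec a m_infty p_infty) Ha_minf B) as [L HL].
    exists (L / eps); intros t Ht; apply HL.
    apply (Rmult_lt_compat_l eps) in Ht; [|exact Heps].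
    now replace (eps * (L / eps)) with L in Ht by (field; lra). }
  destruct (heteroclinic_exists V A) as [x [v [Hx [Hv [Hb Htail]]]]]; auto.
  { intros t; destruct Ha_inf as [m [Hm Hma]]; specialize (Hma (eps * t)); unfold A; lra. }
  assert (Dx : forall t, Derive x t = v t) by (intros t; apply is_derive_unique, Hx).
  assert (Dxx : forall t, is_derive (Derive x) t (A t * Derive V (x t))).
  { intros t; apply is_derive_ext with (2 := Hv t); intros s; symmetry; apply Dx. }
  assert (Dxx' : forall t, Derive (Derive x) t = A t * Derive V (x t))
    by (intros t; apply is_derive_unique, Dxx).
  assert (Hlimm : is_lim x m_infty (-1)).
  { apply is_lim_spec; intros e.
    pose proof (cond_pos e).
    (* The cap [1 / 2] keeps the tolerance below [1], and [e / 2] makes the final inequality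
       strict. *)
    destruct (Htail (Rmin (e / 2) (1 / 2))) as [L HL].
    { split; [apply Rmin_pos; lra|]. pose proof (Rmin_r (e / 2) (1 / 2)); lra. }
    exists (- L); intros t Ht.
    pose proof (proj2 (HL t) Ht); pose proof (Hb t); pose proof (Rmin_l (e / 2) (1 / 2)).
    apply Rabs_def1; lra. }
  assert (Hlimp : is_lim x p_infty 1).
  { apply is_lim_spec; intros e.
    pose proof (cond_pos e).
    destruct (Htail (Rmin (e / 2) (1 / 2))) as [L HL].
    { split; [apply Rmin_pos; lra|]. pose proof (Rmin_r (e / 2) (1 / 2)); lra. }
    exists L; intros t Ht.
    pose proof (proj1 (HL t) Ht); pose proof (Hb t); pose proof (Rmin_l (e / 2) (1 / 2)).
    apply Rabs_def1; lra. }
  exists x; split; [|split; [exact Dxx'|split; [exact Hlimm|split; [exact Hlimp|]]]].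
  - intros t; split; [|split].
    + exists (v t); apply Hx.
    + eexists; apply Dxx.
    + apply (continuous_ext (fun s => mult (A s) (Derive V (x s)))).
      { intros s; symmetry; apply Dxx'. }
      apply (continuous_mult (K := R_AbsRing)); [apply HA|].
      apply (continuous_comp x (Derive V)).
      * apply (ex_derive_continuous (V := R_NormedModule)); exists (v t); apply Hx.
      * apply (ex_derive_continuous (V := R_NormedModule)), HV.
  (* The tails give [x (L + 1) >= 1 / 2] and [x (- L - 1) <= - 1 / 2], so [x] is not constant and
     cannot touch an equilibrium. *)
  - destruct (Htail (1 / 2) ltac:(lra)) as [L HL].
    pose proof (proj1 (HL (L + 1)) ltac:(lra)) as Hr.
    pose proof (proj2 (HL (- L - 1)) ltac:(lra)) as Hl.
    assert (Hne : forall c t, c = 1 \/ c = -1 -> x t <> c).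
    { intros c t Hc Hxc.
      assert (HVc : Derive V c = 0).
      { apply derive_zero_of_min; [apply HV|intros z].
        destruct Hc as [-> | ->]; [rewrite HV1|rewrite HVm1]; apply HVnonneg. }
      pose proof (touching_constant V A x v c t HV HA Hx Hv Hb Hc HVc Hxc) as Hcst.
      rewrite Hcst in Hr, Hl; lra. }
    intros t; pose proof (Hb t).
    pose proof (Hne 1 t (or_introl eq_refl)); pose proof (Hne (-1) t (or_intror eq_refl)).
    lra.
Qed.
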